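(* Let $\alpha\in\{\alpha_1,\alpha_2\}$ and assume that $N:=-\lambda_1-\alpha$ is a non-negative integer and that $q^{n-\beta}\neq 1$ for $n=1,2,\dots,N$ (for real $\beta$ this says $\beta\notin\{1,2,\dots,N\}$). Let $c_n(E)$ $(-1\le n\le N+1)$ be the polynomials in $E$ defined in the context. If $E=E_0$ is a solution of the algebraic equation $c_{N+1}(E)=0$, then the $q$-Heun equation with $E=E_0$ has a non-zero solution of the form $$f(x)=x^{\lambda_1}\sum_{n=0}^{N}c_n(E_0)\,x^n .$$
   Context: Throughout $0<q<1$. The parameters $t_1,t_2,h_1,h_2,l_1,l_2,\alpha_1,\alpha_2,\beta$ are complex numbers with $t_1t_2\neq 0$, and $q^{s}=e^{s\log q}$. The $q$-Heun equation with accessory parameter $E$ is the $q$-difference equation for $g$ $$(x-q^{h_1+1/2}t_1)(x-q^{h_2+1/2}t_2)\,g(x/q)+q^{\alpha_1+\alpha_2}(x-q^{l_1-1/2}t_1)(x-q^{l_2-1/2}t_2)\,g(qx)$$ $$-\{(q^{\alpha_1}+q^{\alpha_2})x^2+Ex+q^{(h_1+h_2+l_1+l_2+\alpha_1+\alpha_2)/2}(q^{\beta/2}+q^{-\beta/2})t_1t_2\}\,g(x)=0 .$$ Set $\lambda_1=(h_1+h_2-l_1-l_2-\alpha_1-\alpha_2-\beta+2)/2$. The power $x^{\lambda_1}$ is understood as a function (e.g. on $x>0$) with $(q^{\pm1}x)^{\lambda_1}=q^{\pm\lambda_1}x^{\lambda_1}$. Polynomials $c_n(E)$: $c_{-1}(E)=0$,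 $c_0(E)=1$. For every $n\ge1$ put $$R_n(E)=c_{n-1}(E)\Big[Eq^{n-1+\lambda_1}+q^{1/2}(q^{h_1}t_1+q^{h_2}t_2)+(q^{l_1}t_1+q^{l_2}t_2)q^{2(n-1+\lambda_1)+\alpha_1+\alpha_2-1/2}\Big]$$ $$-c_{n-2}(E)\,q\,(1-q^{n-2+\lambda_1+\alpha_1})(1-q^{n-2+\lambda_1+\alpha_2}).$$ For $n=1,\dots,N$, $c_n(E)$ is determined recursively by $c_n(E)\,t_1t_2q^{h_1+h_2}(1-q^n)(1-q^{n-\beta})=R_n(E)$. The polynomial $c_{N+1}(E)$ is determined by the same relation with $n=N+1$ if $q^{N+1-\beta}\ne1$, and by $c_{N+1}(E)=R_{N+1}(E)$ if $q^{N+1-\beta}=1$. *)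

(* Defs.v *)
From mathcomp Require Import all_boot all_order all_algebra.
From mathcomp Require Import all_classical all_reals all_analysis.
From mathcomp Require Export complex.
From mathcomp Require Import ring.

Set Implicit Arguments.
Unset Strict Implicit.
Unset Printing Implicit Defensive.

Import Order.TTheory GRing.Theory Num.Theory.
Local Open Scope classical_set_scope.
Local Open Scope ring_scope.
Local Open Scope complex_scope.

Definition cexp (R : realType) (z : R[i]) : R[i] :=
  let: a +i* b := z in (expR a * cos b) +i* (expR a * sin b).

(* a ^ s = e ^ (s log a); only meaningful for a > 0. *)
Definition cpow (R : realType) (a : R) (s : R[i]) : R[i] :=
  cexp (s * (ln a)%:C).

(* The q-Heun equation for g with accessory parameter E, at the point x. *)
Definition qHeun_eq (R : realType) (q : R)
    (t1 t2 h1 h2 l1 l2 alpha1 alpha2 beta E : R[i]) (g : R[i] -> R[i])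
    (x : R[i]) : Prop :=
  (x - cpow q (h1 + 1 / 2) * t1) * (x - cpow q (h2 + 1 / 2) * t2)
    * g (x / q%:C)
  + cpow q (alpha1 + alpha2)
    * (x - cpow q (l1 - 1 / 2) * t1) * (x - cpow q (l2 - 1 / 2) * t2)
    * g (q%:C * x)
  - ((cpow q alpha1 + cpow q alpha2) * x ^+ 2 + E * x
     + cpow q ((h1 + h2 + l1 + l2 + alpha1 + alpha2) / 2)
       * (cpow q (beta / 2) + cpow q (- beta / 2)) * t1 * t2) * g x = 0.

Definition lambda1 (R : realType) (h1 h2 l1 l2 alpha1 alpha2 beta : R[i]) :
    R[i] :=
  (h1 + h2 - l1 - l2 - alpha1 - alpha2 - beta + 2) / 2.

(* R_n (n >= 1), as a polynomial in E = 'X, in terms of cn1 = c_(n-1) and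
   cn2 = c_(n-2). *)
Definition qHeun_rhs (R : realType) (q : R)
    (t1 t2 h1 h2 l1 l2 alpha1 alpha2 beta : R[i]) (n : nat)
    (cn1 cn2 : {poly R[i]}) : {poly R[i]} :=
  let lam := lambda1 h1 h2 l1 l2 alpha1 alpha2 beta in
  cn1 * ('X * (cpow q (n%:R - 1 + lam))%:P
         + (cpow q (1 / 2) * (cpow q h1 * t1 + cpow q h2 * t2))%:P
         + ((cpow q l1 * t1 + cpow q l2 * t2)
            * cpow q (2 * (n%:R - 1 + lam) + alpha1 + alpha2 - 1 / 2))%:P)
  - cn2 * (q%:C * (1 - cpow q (n%:R - 2 + lam + alpha1))
                * (1 - cpow q (n%:R - 2 + lam + alpha2)))%:P.

(* The coefficients c_n for n >= 0, with c_(-1) = 0 inlined. The resonant case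
   q ^ (n - beta) = 1 can only occur at n = N + 1 under the assumptions of the
   theorem; see qHeun_coef_regular and qHeun_coef_resonant. *)
Fixpoint qHeun_coef (R : realType) (q : R)
    (t1 t2 h1 h2 l1 l2 alpha1 alpha2 beta : R[i]) (n : nat) : {poly R[i]} :=
  match n with
  | 0 => 1
  | m.+1 =>
    let c := qHeun_coef q t1 t2 h1 h2 l1 l2 alpha1 alpha2 beta in
    let Rn := qHeun_rhs q t1 t2 h1 h2 l1 l2 alpha1 alpha2 beta m.+1
                (c m) (match m with 0 => 0 | k.+1 => c k end) in
    if cpow q (m.+1%:R - beta) == 1 then Rn
    else (t1 * t2 * cpow q (h1 + h2) * (1 - cpow q m.+1%:R)
          * (1 - cpow q (m.+1%:R - beta)))^-1 *: Rn
  end.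

(* p is a branch of the power x ^ lam on D: D is stable under x |-> q ^ (+-1) x,
   p has the multipliers q ^ (+-lam), and p is not identically zero off the
   origin. The principal power on x > 0 is an instance, see
   principal_power_branch. *)
Record power_branch (R : realType) (q : R) (lam : R[i]) (D : set R[i])
    (p : R[i] -> R[i]) : Prop := PowerBranch {
  power_branch_dom : forall x, D x -> D (q%:C * x) /\ D (x / q%:C);
  power_branch_mul : forall x, D x -> p (q%:C * x) = cpow q lam * p x;
  power_branch_div : forall x, D x -> p (x / q%:C) = cpow q (- lam) * p x;
  power_branch_neq0 : exists x, [/\ D x, x != 0 & p x != 0] }.

Lemma cexpD (R : realType) (z w : R[i]) : cexp (z + w) = cexp z * cexp w.
Proof.
case: z w => [a b] [c d]; rewrite /cexp /= expRD cosD sinD.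
by apply/eqP; rewrite eq_complex /=; apply/andP; split; apply/eqP; ring.
Qed.

Lemma cexp_neq0 (R : realType) (z : R[i]) : cexp z != 0.
Proof.
apply/eqP => z0; have := cexpD z (- z).
rewrite z0 mul0r subrr /cexp /= expR0 cos0 sin0 mulr1 => /eqP.
by rewrite eq_complex /= oner_eq0.
Qed.

Lemma cpowM (R : realType) (a b : R) (s : R[i]) :
  0 < a -> 0 < b -> cpow (a * b) s = cpow a s * cpow b s.
Proof. by move=> a0 b0; rewrite /cpow lnM// rmorphD mulrDr cexpD. Qed.

Lemma cpowV (R : realType) (a : R) (s : R[i]) :
  0 < a -> cpow a^-1 s = cpow a (- s).
Proof. by move=> a0; rewrite /cpow lnV// rmorphN mulrN mulNr. Qed.

Lemma cpow_natr (R : realType) (a : R) (n : nat) :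
  0 < a -> cpow a n%:R = (a ^+ n)%:C.
Proof.
move=> a0; rewrite /cpow -(rmorph_nat (real_complex R)) -rmorphM /cexp /=.
by rewrite cos0 sin0 mulr1 mulr0 expRM_natl lnK.
Qed.

Lemma principal_power_branch (R : realType) (q : R) (lam : R[i]) : 0 < q ->
  power_branch q lam [set x%:C | x in [set x : R | 0 < x]]
    (fun x => cpow (complex.Re x) lam).
Proof.
move=> q0; split.
- move=> _ [x /= x0 <-]; split.
    by exists (q * x); [exact: mulr_gt0|rewrite rmorphM].
  by exists (x / q); [exact: divr_gt0|rewrite rmorphM fmorphV].
- by move=> _ [x /= x0 <-]; rewrite -rmorphM /= cpowM.
- move=> _ [x /= x0 <-].
  by rewrite -fmorphV -rmorphM /= cpowM ?invr_gt0// cpowV// mulrC.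
- exists 1; split; [by exists 1; [exact: ltr01|]|exact: oner_neq0|].
  exact: cexp_neq0.
Qed.

Section Recursion.
Variables (R : realType) (q : R).
Variables (t1 t2 h1 h2 l1 l2 alpha1 alpha2 beta : R[i]).
Let c := qHeun_coef q t1 t2 h1 h2 l1 l2 alpha1 alpha2 beta.
Let rhs (n : nat) := qHeun_rhs q t1 t2 h1 h2 l1 l2 alpha1 alpha2 beta n
  (c n.-1) (if n == 1 then 0 else c n.-2).

Lemma qHeun_coef_regular n : 0 < q < 1 -> t1 * t2 != 0 -> (0 < n)%N ->
  cpow q (n%:R - beta) != 1 ->
  c n * (t1 * t2 * cpow q (h1 + h2) * (1 - cpow q n%:R)
         * (1 - cpow q (n%:R - beta)))%:P = rhs n.
Proof.
case: n => // m /andP[q0 q1] t0 _ qb.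
have -> : c m.+1 = (t1 * t2 * cpow q (h1 + h2) * (1 - cpow q m.+1%:R)
    * (1 - cpow q (m.+1%:R - beta)))^-1 *: rhs m.+1.
  by rewrite {1}/c /= (negbTE qb); case: m {qb}.
rewrite mulrC mul_polyC scalerA divff ?scale1r// !mulf_neq0 ?cexp_neq0//.
- by move: t0; rewrite mulf_eq0 negb_or => /andP[].
- by move: t0; rewrite mulf_eq0 negb_or => /andP[].
- rewrite subr_eq0 eq_sym cpow_natr// -(rmorph1 (real_complex R)).
  by rewrite (inj_eq (@complexI R)) lt_eqF// exprn_ilt1// ltW.
- by rewrite subr_eq0 eq_sym.
Qed.

Lemma qHeun_coef_resonant n : (0 < n)%N -> cpow q (n%:R - beta) = 1 ->
  c n = rhs n.
Proof. by case: n => // m _ qb; rewrite {1}/c /= qb eqxx; case: m {qb}. Qed.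

End Recursion.

(* Main.v *)
Require Import Defs.
From mathcomp Require Import all_boot all_order all_algebra.
From mathcomp Require Import all_classical all_reals all_analysis.
From mathcomp Require Import ring.

Set Implicit Arguments.
Unset Strict Implicit.
Unset Printing Implicit Defensive.

Import Order.TTheory GRing.Theory Num.Theory.
Local Open Scope classical_set_scope.
Local Open Scope ring_scope.
Local Open Scope complex_scope.

(** The q-Heun operator sends x ^ (lambda1 + n) to x ^ (lambda1 + n) times a
    quadratic polynomial in x (qHeun_symbol).  The exponent lambda1 is chosen
    so that the constant term of this polynomial is, up to a power of q,
    t1 t2 q ^ (h1 + h2) (1 - q ^ n) (1 - q ^ (n - beta)), which vanishes at
    n = 0.  Its coefficients of x and x ^ 2 are, up to sign and a power of q,
    the bracket in R_(n+1) and the factor of c_n in R_(n+2) (qHeun_symbolE).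
    Hence the relation defining c_n says that the coefficient of
    x ^ (lambda1 + n) in the image of x ^ lambda1 * \sum_n c_n x ^ n is zero.

    When the series is cut after c_M, all coefficients up to x ^ M cancel and
    only those of x ^ (M + 1) and x ^ (M + 2) survive: up to nonzero factors
    they are R_(M+1) and
    c_M (1 - q ^ (lambda1 + M + alpha1)) (1 - q ^ (lambda1 + M + alpha2))
    (qHeun_truncated_sum).  At M = N the first one vanishes because
    c_(N+1)(E0) = 0 forces R_(N+1)(E0) = 0, in the resonant case as well as in
    the regular one, and the second one because lambda1 + N + alpha = 0 for one
    of the two exponents alpha.

    The solution is non-zero because the polynomial factor has constant term
    c_0 = 1, so it cannot vanish on a whole orbit q ^ k x0 with x0 != 0
    (nonroot_geometric), whereas the branch of x ^ lambda1 stays non-zero along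
    the orbit of a point where it is non-zero (power_branch_orbit). *)

(** * Powers with a fixed base *)

Section Cpow.
Variables (R : realType) (q : R).

Lemma cpowD (s t : R[i]) : cpow q (s + t) = cpow q s * cpow q t.
Proof. by rewrite /cpow mulrDl cexpD. Qed.

Lemma cpow_neq0 (s : R[i]) : cpow q s != 0.
Proof. exact: cexp_neq0. Qed.

Lemma cpow0 : cpow q 0 = 1.
Proof.
by apply: (mulfI (cpow_neq0 0)); rewrite -cpowD addr0 mulr1.
Qed.

Lemma cpowN (s : R[i]) : cpow q (- s) = (cpow q s)^-1.
Proof.
by apply: (mulfI (cpow_neq0 s)); rewrite -cpowD subrr cpow0 divff ?cpow_neq0.
Qed.

End Cpow.

(** * Polynomials on geometric progressions *)

(** The points q ^ k x0 are pairwise distinct, so they outnumber the roots. *)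
Lemma nonroot_geometric (F : numFieldType) (q x0 : F) (P : {poly F}) :
  0 < q -> q != 1 -> x0 != 0 -> P != 0 -> exists k, P.[q ^+ k * x0] != 0.
Proof.
move=> q0 q1 x00 P0; apply: contrapT => noroot.
have root_all : all (root P) [seq q ^+ k * x0 | k <- iota 0 (size P)].
  apply/allP => _ /mapP[k _ ->]; apply/negP => nroot.
  by apply: noroot; exists k; apply/negP.
have /(max_poly_roots P0 root_all) :
    uniq [seq q ^+ k * x0 | k <- iota 0 (size P)].
  rewrite map_inj_uniq ?iota_uniq// => i j /(mulIf x00).
  exact: ieexprIn.
by rewrite size_map size_iota ltnn.
Qed.

(** Each step along the orbit multiplies p by q ^ lam, which is non-zero. *)
Lemma power_branch_orbit (R : realType) (q : R) (lam x : R[i]) (D : set R[i])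
    (p : R[i] -> R[i]) (k : nat) :
  power_branch q lam D p -> D x -> p x != 0 ->
  D (q%:C ^+ k * x) /\ p (q%:C ^+ k * x) != 0.
Proof.
move=> hp Dx px0; elim: k => [|k [Dk pk]]; first by rewrite expr0 mul1r.
rewrite exprS -mulrA; split; first by have [] := power_branch_dom hp Dk.
by rewrite (power_branch_mul hp Dk) mulf_neq0// cpow_neq0.
Qed.

(** * The action of the q-Heun operator on power series *)

Section Symbol.
Variables (R : realType) (q : R).
Variables (t1 t2 h1 h2 l1 l2 alpha1 alpha2 beta E : R[i]).
Hypothesis hq : 0 < q < 1.
Hypothesis ht : t1 * t2 != 0.

Let lam := lambda1 h1 h2 l1 l2 alpha1 alpha2 beta.
Let c (n : nat) := qHeun_coef q t1 t2 h1 h2 l1 l2 alpha1 alpha2 beta n.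
Let rhs (n : nat) := qHeun_rhs q t1 t2 h1 h2 l1 l2 alpha1 alpha2 beta n
  (c n.-1) (if n == 1 then 0 else c n.-2).

(** The quotient by x ^ (lambda1 + n) of the image of x ^ (lambda1 + n) under
    the q-Heun operator. *)
Definition qHeun_symbol (n : nat) (x : R[i]) : R[i] :=
  (x - cpow q (h1 + 1 / 2) * t1) * (x - cpow q (h2 + 1 / 2) * t2)
    * cpow q (- (lam + n%:R))
  + cpow q (alpha1 + alpha2)
    * (x - cpow q (l1 - 1 / 2) * t1) * (x - cpow q (l2 - 1 / 2) * t2)
    * cpow q (lam + n%:R)
  - ((cpow q alpha1 + cpow q alpha2) * x ^+ 2 + E * x
     + cpow q ((h1 + h2 + l1 + l2 + alpha1 + alpha2) / 2)
       * (cpow q (beta / 2) + cpow q (- beta / 2)) * t1 * t2).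

Definition symbol_coef0 (n : nat) : R[i] :=
  t1 * t2 * cpow q (h1 + h2) * (1 - cpow q n%:R) * (1 - cpow q (n%:R - beta)).

Definition symbol_coef1 (n : nat) : R[i] :=
  E * cpow q (n%:R + lam) + cpow q (1 / 2) * (cpow q h1 * t1 + cpow q h2 * t2)
  + (cpow q l1 * t1 + cpow q l2 * t2)
    * cpow q (2 * (n%:R + lam) + alpha1 + alpha2 - 1 / 2).

Definition symbol_coef2 (n : nat) : R[i] :=
  (1 - cpow q (n%:R + lam + alpha1)) * (1 - cpow q (n%:R + lam + alpha2)).

Let cpow1 : cpow q 1 = q%:C.
Proof. by case/andP: hq => q0 _; rewrite (cpow_natr 1 q0) expr1. Qed.

(** The choice of lambda1 makes the two powers q ^ ((S +- beta) / 2) of the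
    constant term, S = h1 + h2 + l1 + l2 + alpha1 + alpha2, monomials in the
    powers attached to the single parameters and to lambda1. *)
Lemma qHeun_symbolE n x :
  qHeun_symbol n x = cpow q (- (lam + n%:R))
    * (q%:C * symbol_coef0 n - x * symbol_coef1 n + x ^+ 2 * symbol_coef2 n).
Proof.
rewrite /qHeun_symbol /symbol_coef0 /symbol_coef1 /symbol_coef2.
set S := ((h1 + h2 + l1 + l2 + alpha1 + alpha2) / 2).
have two0 : 2 != 0 :> R[i] by rewrite pnatr_eq0.
have -> : cpow q S * (cpow q (beta / 2) + cpow q (- beta / 2)) =
    cpow q (h1 + h2 + 1 - lam) + cpow q (alpha1 + alpha2 + l1 + l2 - 1 + lam).
  rewrite mulrDr -!cpowD /S /lam /lambda1.
  by congr (cpow q _ + cpow q _); field.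
have -> : n%:R - beta = n%:R + (lam + lam + alpha1 + alpha2 + l1 + l2
    - h1 - h2 - 1 - 1).
  by rewrite /lam /lambda1; field.
have -> : 2 * (n%:R + lam) + alpha1 + alpha2 - 1 / 2
    = n%:R + n%:R + lam + lam + alpha1 + alpha2 - 1 / 2 by ring.
have qE : q%:C = cpow q (1 / 2) * cpow q (1 / 2).
  by rewrite -cpowD -cpow1; congr (cpow q _); field.
rewrite !(cpowD, cpowN, opprD, opprK) !cpow1 !qE.
by field; rewrite !cpow_neq0.
Qed.

Lemma coef_regular n : (0 < n)%N -> cpow q (n%:R - beta) != 1 ->
  (c n).[E] * symbol_coef0 n = (rhs n).[E].
Proof.
by move=> n0 hb; rewrite /rhs -qHeun_coef_regular// hornerM hornerC.
Qed.

Lemma rhs1E : (rhs 1).[E] = symbol_coef1 0.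
Proof.
rewrite /rhs /qHeun_rhs /= mul0r subr0 (_ : c 0 = 1)//.
rewrite !(hornerM, hornerD, hornerX, hornerC) subrr.
exact: mul1r.
Qed.

Lemma rhsSE n : (rhs n.+2).[E] =
  (c n.+1).[E] * symbol_coef1 n.+1 - (c n).[E] * (q%:C * symbol_coef2 n).
Proof.
rewrite /rhs /qHeun_rhs /=.
rewrite hornerD hornerN !(hornerM, hornerD, hornerX, hornerC).
have -> : n.+2%:R - 1 = n.+1%:R :> R[i] by rewrite -[n.+2]addn1 natrD addrK.
have -> : n.+2%:R - 2 = n%:R :> R[i] by rewrite -[n.+2]addn2 natrD addrK.
by rewrite -/lam /symbol_coef1 /symbol_coef2 !mulrA.
Qed.

(** A sum cut after the index M is mapped to two boundary terms, of degrees
    M + 1 and M + 2: adding the next summand cancels the first one by the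
    recursion and turns the second one into part of the new first one. *)
Lemma qHeun_truncated_sum M x :
  (forall n, (1 <= n <= M)%N -> cpow q (n%:R - beta) != 1) ->
  \sum_(0 <= n < M.+1) (c n).[E] * x ^+ n * qHeun_symbol n x
  = x ^+ M.+1 * cpow q (- (lam + M%:R))
    * (x * (c M).[E] * symbol_coef2 M - (rhs M.+1).[E]).
Proof.
elim: M => [_|M IH hb].
  rewrite big_nat1 qHeun_symbolE rhs1E /symbol_coef0 cpow0 hornerC.
  by ring.
rewrite big_nat_recr//= IH; last first.
  by move=> n /andP[n1 nM]; apply: hb; rewrite n1 (leqW nM).
rewrite qHeun_symbolE rhsSE -(@coef_regular M.+1)//; last first.
  by apply: hb; rewrite leqnn.
have -> : cpow q (- (lam + M%:R)) = q%:C * cpow q (- (lam + M.+1%:R)).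
  by rewrite -cpow1 -cpowD; congr (cpow q _); rewrite -natr1; ring.
by rewrite !exprS; ring.
Qed.

(** Conversion of the q-shifts of the product p x * \sum_n a_n x ^ n into
    multiplication of each monomial by its symbol. *)
Lemma qHeun_eq_symbol (a : nat -> R[i]) N (D : set R[i]) (p : R[i] -> R[i]) x :
  power_branch q lam D p -> D x ->
  \sum_(0 <= n < N) a n * x ^+ n * qHeun_symbol n x = 0 ->
  qHeun_eq q t1 t2 h1 h2 l1 l2 alpha1 alpha2 beta E
    (fun y => p y * \sum_(0 <= n < N) a n * y ^+ n) x.
Proof.
move=> hp Dx sum0; rewrite /qHeun_eq.
rewrite (power_branch_mul hp Dx) (power_branch_div hp Dx).
transitivity (p x * \sum_(0 <= n < N) a n * x ^+ n * qHeun_symbol n x);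
  last by rewrite sum0 mulr0.
rewrite !mulr_sumr -big_split -sumrB /=.
apply: eq_bigr => n _; rewrite /qHeun_symbol !exprMn exprVn.
have qn : q%:C ^+ n = cpow q n%:R.
  by case/andP: hq => q0 _; rewrite cpow_natr// rmorphXn.
by rewrite qn opprD (cpowD q (- lam)) (cpowD q lam) (cpowN q n%:R); ring.
Qed.

(** A root of c_n is a root of R_n whether or not c_n is obtained from R_n by a
    division. *)
Lemma root_rhs n : (0 < n)%N -> (c n).[E] = 0 -> (rhs n).[E] = 0.
Proof.
move=> n0 cn0; have [hb|hb] := eqVneq (cpow q (n%:R - beta)) 1.
  by rewrite /rhs -qHeun_coef_resonant.
by rewrite -coef_regular// cn0 mul0r.
Qed.

Lemma symbol_coef2_eq0 alpha n : alpha = alpha1 \/ alpha = alpha2 ->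
  - lam - alpha = n%:R -> symbol_coef2 n = 0.
Proof.
move=> halpha hn; rewrite /symbol_coef2.
have alpha0 : n%:R + lam + alpha = 0 by rewrite -hn; ring.
by case: halpha => <-; rewrite alpha0 cpow0 subrr ?mulr0 ?mul0r.
Qed.

End Symbol.

Theorem proposition2p2 (R : realType) (q : R)
    (t1 t2 h1 h2 l1 l2 alpha1 alpha2 beta : R[i])
    (hq : 0 < q < 1) (ht : t1 * t2 != 0)
    (alpha : R[i]) (halpha : alpha = alpha1 \/ alpha = alpha2)
    (N : nat)
    (hN : - lambda1 h1 h2 l1 l2 alpha1 alpha2 beta - alpha = N%:R)
    (hbeta : forall n : nat, (1 <= n <= N)%N -> cpow q (n%:R - beta) != 1)
    (E0 : R[i])
    (hE0 : (qHeun_coef q t1 t2 h1 h2 l1 l2 alpha1 alpha2 beta N.+1).[E0] = 0)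
    (D : set R[i]) (p : R[i] -> R[i])
    (hp : power_branch q (lambda1 h1 h2 l1 l2 alpha1 alpha2 beta) D p) :
  let f := fun x : R[i] => p x * \sum_(0 <= n < N.+1)
    (qHeun_coef q t1 t2 h1 h2 l1 l2 alpha1 alpha2 beta n).[E0] * x ^+ n in
  (forall x, D x -> qHeun_eq q t1 t2 h1 h2 l1 l2 alpha1 alpha2 beta E0 f x) /\
  (exists x, D x /\ f x != 0).
Proof.
move=> f; split=> [x Dx|].
  apply: (qHeun_eq_symbol hq hp Dx).
  rewrite qHeun_truncated_sum// (symbol_coef2_eq0 q halpha hN).
  by rewrite (root_rhs hq ht _ hE0)// mulr0 subrr mulr0.
have [x0 [Dx0 x00 px0]] := power_branch_neq0 hp.
pose P := \poly_(n < N.+1)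
  (qHeun_coef q t1 t2 h1 h2 l1 l2 alpha1 alpha2 beta n).[E0].
have P0 : P != 0.
  apply/eqP => /(congr1 (fun r : {poly R[i]} => r`_0)).
  by rewrite coef_poly /= hornerC coef0 => /eqP; rewrite oner_eq0.
have /andP[q0 q1] := hq.
have [k Pk] : exists k, P.[q%:C ^+ k * x0] != 0.
  apply: nonroot_geometric => //; first by rewrite ltcR.
  by rewrite -(rmorph1 (real_complex R)) (inj_eq (@complexI R)) lt_eqF.
have [Dk pk] := power_branch_orbit k hp Dx0 px0.
exists (q%:C ^+ k * x0); split=> //; rewrite mulf_neq0//.
by move: Pk; rewrite horner_poly big_mkord.
Qed.
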